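(* Let $f$ be a continuous function on $B_1$ with $0<\nu\le f(x)\le M<\infty$ for all $x\in B_1$, let $u\in C(\overline{B_1})$ be a viscosity solution of $$\min\{f(x)-\Delta_\infty u,\ u\}=0\ \text{ in }B_1,$$ and let $y_0\in\overline{\{u>0\}}\cap B_1$. Then there is a constant $c>0$, depending only on $\nu$, such that $$\sup_{B_r(y_0)}u\ge c\,r^{4/3}$$ for every $r>0$ with $B_r(y_0)\subset B_1$.
   Context: $B_r(x)$ is the open ball of radius $r$ and center $x$ in $\mathbb{R}^n$, $B_1=B_1(0)$, and $\Delta_\infty u=\sum_{i,j}u_{x_i}u_{x_j}u_{x_ix_j}$. A continuous function $u$ satisfies $\min\{f-\Delta_\infty u,u\}=0$ in $B_1$ in the viscosity sense if $u\ge0$ in $B_1$, $\Delta_\infty u\le f$ in $B_1$, and $\Delta_\infty u\ge f$ in $\{u>0\}$, the last two inequalities in the viscosity sense. Here $\Delta_\infty u\le f$ (resp. $\ge f$) in an open set in the viscosity sense means: whenever $\varphi\in C^2$ touches $u$ from below (resp. from above) at a point $x$ of that set, $\Delta_\infty\varphi(x)\le f(x)$ (resp. $\ge f(x)$). *)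

(* Defs.v *)
From HB Require Import structures.
From mathcomp Require Import all_boot all_order all_algebra.
From mathcomp Require Import all_classical all_reals all_analysis.

Set Implicit Arguments.
Unset Strict Implicit.
Unset Printing Implicit Defensive.

Import Order.TTheory GRing.Theory Num.Theory.
Import numFieldNormedType.Exports.

Local Open Scope classical_set_scope.
Local Open Scope ring_scope.

Section Defs.
Context {R : realType} {n : nat}.
Implicit Types (x y : 'rV[R]_n) (U : set 'rV[R]_n) (u f phi : 'rV[R]_n -> R).

(* The library norm on ['rV[R]_n] is the sup norm; it induces the same
   topology, but its balls are cubes. *)
Definition enorm x : R := Num.sqrt (\sum_(i < n) x 0 i ^+ 2).

Definition eball x (r : R) : set 'rV[R]_n := [set y | enorm (y - x) < r].

Definition partial (i : 'I_n) phi : 'rV[R]_n -> R :=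
  fun x => 'D_(delta_mx 0 i) phi x.

(* Meant for open [U]: continuity at a point is continuity on a full
   neighbourhood, not relative to [U]. *)
Definition C1_on U phi : Prop := forall x, U x ->
  {for x, continuous phi} /\
  forall i : 'I_n,
    derivable phi x (delta_mx 0 i) /\ {for x, continuous (partial i phi)}.

Definition C2_on U phi : Prop :=
  C1_on U phi /\ forall i : 'I_n, C1_on U (partial i phi).

Definition inf_laplacian phi x : R :=
  \sum_(i < n) \sum_(j < n)
    partial i phi x * partial j phi x * partial j (partial i phi) x.

Definition touches_below phi u x : Prop :=
  phi x = u x /\ \forall y \near x, phi y <= u y.

Definition touches_above phi u x : Prop :=
  phi x = u x /\ \forall y \near x, u y <= phi y.

Definition visc_inf_laplacian_le U u f : Prop :=
  forall phi x, C2_on U phi -> U x -> touches_below phi u x ->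
    inf_laplacian phi x <= f x.

Definition visc_inf_laplacian_ge U u f : Prop :=
  forall phi x, C2_on U phi -> U x -> touches_above phi u x ->
    f x <= inf_laplacian phi x.

Definition positivity_set U u : set 'rV[R]_n := U `&` [set x | 0 < u x].

Definition visc_obstacle_solution U u f : Prop :=
  [/\ forall x, U x -> 0 <= u x,
      visc_inf_laplacian_le U u f
    & visc_inf_laplacian_ge (positivity_set U u) u f].

End Defs.

(* Main.v *)
Require Import Defs.
From HB Require Import structures.
From mathcomp Require Import all_boot all_order all_algebra.
From mathcomp Require Import all_classical all_reals all_analysis.
From mathcomp Require Import ring lra.
Import Order.TTheory GRing.Theory Num.Theory.
Import numFieldNormedType.Exports.
Local Open Scope classical_set_scope.
Local Open Scope ring_scope.

(** Compare [u] with the paraboloid [a |x - x0|^2], [a ~ r^(-2/3)], where [x0]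
    is a point of [{u > 0}] close to [y0].  On the ball of radius [r/2] about
    [x0] the infinity Laplacian [8 a^3 |x - x0|^2] of the paraboloid is smaller
    than [nu], so [u - a |x - x0|^2], which is positive at [x0], cannot attain
    its maximum in the interior; on the sphere this gives
    [u > a (r/2)^2 ~ r^(4/3)].  Since [r] is fixed, this smooth barrier can
    replace the usual [|x - x0|^(4/3)], which is not [C^2] at [x0]. *)

(** The square of [enorm] is a polynomial in the coordinates, hence smooth everywhere; no square
    root has to be differentiated. *)
Definition sqnorm {R : realType} {n : nat} (x : 'rV[R]_n) : R :=
  \sum_(i < n) x 0 i ^+ 2.

Section SquaredNorm.
Context {R : realType} {n : nat}.
Implicit Types (x y z : 'rV[R]_n) (r a k : R).

Lemma sqnorm_ge0 x : 0 <= sqnorm x.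
Proof. by apply: sumr_ge0 => i _; exact: sqr_ge0. Qed.

Lemma enorm_lt_sqnorm x r : 0 < r -> (enorm x < r) = (sqnorm x < r ^+ 2).
Proof.
move=> r0; rewrite /enorm -{1}(ger0_norm (ltW r0)) -sqrtr_sqr.
by rewrite ltr_sqrt// exprn_gt0.
Qed.

Lemma sqnorm_parallelogram_le x y : sqnorm (x + y) <= 2 * (sqnorm x + sqnorm y).
Proof.
rewrite -big_split mulr_sumr; apply: ler_sum => i _; rewrite mxE /=.
rewrite -subr_ge0; have := sqr_ge0 (x 0 i - y 0 i); nra.
Qed.

Lemma sqr_coord_le_sqnorm x i : x 0 i ^+ 2 <= sqnorm x.
Proof.
rewrite /sqnorm (bigD1 i)//= lerDl.
by apply: sumr_ge0 => j _; exact: sqr_ge0.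
Qed.

(** * Topology of Euclidean balls *)

Lemma continuous_affine (g : 'rV[R]_n -> R) a k :
  continuous g -> continuous (fun y => a * g y + k).
Proof.
move=> gc y; exact: (cvgD (cvgM (cvg_cst a) (gc y)) (cvg_cst k)).
Qed.

Lemma continuous_coord_sub z (i : 'I_n) :
  continuous (fun y : 'rV[R]_n => (y - z) 0 i).
Proof.
have -> : (fun y : 'rV[R]_n => (y - z) 0 i) = (fun y => y 0 i - z 0 i).
  by apply/funext => y; rewrite !mxE.
by move=> y; exact: (cvgB (@coord_continuous _ _ _ 0 i y) (cvg_cst (z 0 i))).
Qed.

Lemma continuous_sqnorm_sub z : continuous (fun y => sqnorm (y - z)).
Proof.
apply: continuous_big => [|i _ y]; first exact: add_continuous.
exact: (cvgM (continuous_coord_sub z i y) (continuous_coord_sub z i y)).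
Qed.

Lemma open_sqnorm_lt z r : open [set y | sqnorm (y - z) < r].
Proof.
exact: ((continuousP _).1 (continuous_sqnorm_sub z) _ (@open_lt _ r)).
Qed.

Lemma closed_sqnorm_le z r : closed [set y | sqnorm (y - z) <= r].
Proof.
exact: ((continuous_closedP _).1 (continuous_sqnorm_sub z) _ (@closed_le _ r)).
Qed.

Lemma compact_sqnorm_le z r : compact [set y | sqnorm (y - z) <= r].
Proof.
apply: bounded_closed_compact; last exact: closed_sqnorm_le.
(* The ambient norm is the sup norm. A coordinate [t] of [y - z] has [t ^+ 2 <= |r|], which forces
   [|t| <= 1 + |r|]. *)
exists (`|z| + (1 + `|r|)); split; first exact: num_real.
move=> t zt y /= yr; apply: le_trans (ltW zt).
rewrite -{1}(subrK z y) addrC (le_trans (ler_normD _ _))// lerD2l.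
rewrite [leLHS]mx_normrE; apply: bigmax_le => [|[i j] _ /=].
  by rewrite addr_ge0.
rewrite ord1; have := le_trans (sqr_coord_le_sqnorm (y - z) j) yr.
have := ler_norm r; have := normr_ge0 r; rewrite -real_normK ?num_real//.
move: `|r| => s s0 rs; have := normr_ge0 ((y - z) 0 j).
move: `|_| => t' t'0 h; nra.
Qed.

(** * Derivatives of the paraboloid *)

Lemma is_derive_coord x z (i : 'I_n) :
  is_derive x z (fun y : 'rV[R]_n => y 0 i) (z 0 i).
Proof.
have d := @derivable_id _ _ x z.
have /derivable_mxP/(_ 0 i) di := d.
apply: DeriveDef => //.
by have := derive_mx d; rewrite derive_id => /matrixP/(_ 0 i); rewrite mxE.
Qed.

Lemma is_derive_coord_affine a x z k (i : 'I_n) y :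
  is_derive y z (fun t : 'rV[R]_n => a * (t - x) 0 i + k) (a * z 0 i).
Proof.
have -> : (fun t : 'rV[R]_n => a * (t - x) 0 i + k) =
   a \*: (fun t : 'rV[R]_n => t 0 i) + cst (k - a * x 0 i).
  by apply/funext => t /=; rewrite !fctE !mxE /= /GRing.scale /=; ring.
apply: is_derive_eq.
  exact: is_deriveD (is_deriveZ a (is_derive_coord y z i)) (is_derive_cst _ _ _).
by rewrite addr0.
Qed.

Lemma is_derive_paraboloid a x k y z :
  is_derive y z (fun t => a * sqnorm (t - x) + k)
    (\sum_(i < n) 2 * a * (y - x) 0 i * z 0 i).
Proof.
have -> : (fun t => a * sqnorm (t - x) + k) =
   a \*: (\sum_(i < n) (fun t : 'rV[R]_n => 1 * (t - x) 0 i + 0) ^+ 2) + cst k.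
  apply/funext => t /=; rewrite !fctE /= fct_sumE; congr (_ * _ + _).
  by apply: eq_bigr => i _; rewrite !fctE mul1r addr0.
apply: is_derive_eq.
  apply: is_deriveD (is_deriveZ a _) (is_derive_cst _ _ _).
  by apply: is_derive_sum => i; exact: is_deriveX (is_derive_coord_affine _ _ _ _ _ _).
rewrite addr0 scaler_sumr; apply: eq_bigr => i _.
by rewrite /GRing.scale /=; ring.
Qed.

Lemma partial_coord_affine a x k (i j : 'I_n) :
  partial j (fun t => a * (t - x) 0 i + k) = cst (a * (i == j)%:R).
Proof.
apply/funext => y; rewrite /partial (@derive_val _ _ _ _ _ _ _ (is_derive_coord_affine a x _ k i y)).
by rewrite mxE.
Qed.

(** The trailing [+ 0] keeps the gradient in the affine form to which [partial_coord_affine]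
    applies, so second derivatives follow by rewriting. *)
Lemma partial_paraboloid a x k (i : 'I_n) :
  partial i (fun t => a * sqnorm (t - x) + k) =
  (fun t => 2 * a * (t - x) 0 i + 0).
Proof.
apply/funext => y; rewrite /partial (@derive_val _ _ _ _ _ _ _ (is_derive_paraboloid a x k y _)).
rewrite (bigD1 i)//= big1 => [|j /negPf ji].
  by rewrite [delta_mx _ _ _ _]mxE !eqxx mulr1.
by rewrite [delta_mx _ _ _ _]mxE ji andbF mulr0.
Qed.

Lemma C2_on_paraboloid a x k U : C2_on U (fun t => a * sqnorm (t - x) + k).
Proof.
have cX (i : 'I_n) : continuous (fun t : 'rV[R]_n => 2 * a * (t - x) 0 i + 0).
  exact: continuous_affine (continuous_coord_sub x i).
split=> [y _|i y _]; split.
- exact: continuous_affine (continuous_sqnorm_sub x) _.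
- move=> i; split; first exact: (@ex_derive _ _ _ _ _ _ _ (is_derive_paraboloid a x k y _)).
  by rewrite partial_paraboloid; exact: cX.
- by rewrite partial_paraboloid; exact: cX.
- move=> j; rewrite partial_paraboloid; split.
    exact: (@ex_derive _ _ _ _ _ _ _ (is_derive_coord_affine (2 * a) x _ 0 i y)).
  by rewrite partial_coord_affine; exact: cst_continuous.
Qed.

(** The Hessian is [2 * a] times the identity, so only the diagonal terms survive, each
    [(2 a t_i)^2 * 2 a] with [t = y - x]. *)
Lemma inf_laplacian_paraboloid a x k y :
  inf_laplacian (fun t => a * sqnorm (t - x) + k) y =
  8 * a ^+ 3 * sqnorm (y - x).
Proof.
rewrite /inf_laplacian mulr_sumr; apply: eq_bigr => i _.
rewrite !partial_paraboloid (bigD1 i)//= big1 => [|j ji].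
  by rewrite partial_paraboloid partial_coord_affine /= eqxx mulr1n; ring.
by rewrite partial_coord_affine /= eq_sym (negPf ji) mulr0n; ring.
Qed.

End SquaredNorm.

(** The infinity Laplacian is cubic in the opening of the paraboloid; cubing makes the fractional
    exponent disappear. *)
Lemma powR_4_3_expr3 {R : realType} (r : R) :
  0 < r -> (r `^ (4%:R / 3%:R)) ^+ 3 = r ^+ 4.
Proof.
move=> r0; rewrite -powR_mulrn ?powR_ge0// -powRrM -powR_mulrn ?ltW//.
by congr (_ `^ _); field.
Qed.

(** [sup] takes a default value on sets that are unbounded above, so values of [u] compare with it
    only once this bound is known. It comes from compactness of the closed unit ball. *)
Lemma has_ubound_within_closed_eball {R : realType} {n : nat}
    {u : 'rV[R]_n -> R} {A : set 'rV[R]_n} :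
  {within closure (eball 0 1), continuous u} -> A `<=` eball 0 1 ->
  has_ubound [set u x | x in A].
Proof.
move=> uC Asub.
have sub : eball 0 1 `<=` [set y : 'rV[R]_n | sqnorm (y - 0) <= 1].
  by move=> y; rewrite /eball /= enorm_lt_sqnorm// expr1n => /ltW.
have cK : compact (closure (eball (0 : 'rV[R]_n) 1)).
  have cB := compact_sqnorm_le (0 : 'rV[R]_n) 1.
  apply: (subclosed_compact (@closed_closure _ _) cB).
  have /closure_id -> := closed_sqnorm_le (0 : 'rV[R]_n) 1.
  exact: closure_subset.
have [b [_ bP]] := compact_bounded (continuous_compact uC cK).
exists (b + 1) => _ [x Ax <-]; apply: le_trans (ler_norm _) _.
apply: (bP (b + 1)); first by rewrite ltrDl.
by exists x => //; apply: subset_closure; exact: Asub.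
Qed.

Theorem theorem3p5 (R : realType) (nu : R) (hnu : 0 < nu) :
  exists2 c : R, 0 < c &
  forall (n : nat) (hn : (0 < n)%N) (M : R) (f u : 'rV[R]_n -> R)
    (y0 : 'rV[R]_n),
    {within eball 0 1, continuous f} ->
    (forall x, eball 0 1 x -> nu <= f x <= M) ->
    {within closure (eball 0 1), continuous u} ->
    visc_obstacle_solution (eball 0 1) u f ->
    (closure (positivity_set (eball 0 1) u) `&` eball 0 1) y0 ->
    forall r : R, 0 < r -> eball y0 r `<=` eball 0 1 ->
      c * r `^ (4%:R / 3%:R) <= sup [set u x | x in eball y0 r].
Proof.
(* The minimum replaces a cube root: [k <= 1] gives [k ^+ 3 <= k], and [k <= nu / 3] then gives
   [2 * k ^+ 3 < nu]. *)
pose k := Num.min 1 (nu / 3).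
have k0 : 0 < k by rewrite lt_min ltr01 divr_gt0.
have k1 : k <= 1 by rewrite ge_min lexx.
have knu : k <= nu / 3 by rewrite ge_min lexx orbT.
have k3 : 2 * k ^+ 3 < nu.
  have : k ^+ 3 <= k by rewrite ler_iXnr// ltW.
  lra.
exists (k / 4); first by rewrite divr_gt0.
move=> n _ M f u y0 _ fnu uC [_ _ uge] [y0cl _] r r0 rsub.
have ubd := has_ubound_within_closed_eball uC rsub.
rewrite leNgt; apply/negP => sup_lt.
have ult y : eball y0 r y -> u y < k / 4 * r `^ (4%:R / 3%:R).
  by move=> yr; apply: le_lt_trans sup_lt; apply: ub_le_sup => //; exists y.
(* [u y0] may vanish, so the centre is moved to a nearby point where [u] is positive. *)
have [x0 [[x0B /= ux0] x0y0]] :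
    positivity_set (eball 0 1) u `&` [set x | sqnorm (x - y0) < (r / 4) ^+ 2]
    !=set0.
  apply: y0cl; apply: open_nbhs_nbhs; split; first exact: open_sqnorm_lt.
  rewrite /= subrr /sqnorm big1; first by rewrite exprn_gt0// divr_gt0.
  by move=> i _; rewrite mxE expr0n.
pose K := [set y : 'rV[R]_n | sqnorm (y - x0) <= (r / 2) ^+ 2].
(* The squared distance to [y0] is at most [2 (1/4 + 1/16) r^2 = 5/8 r^2]. *)
have Ksub : K `<=` eball y0 r.
  move=> y yK; rewrite /eball /= enorm_lt_sqnorm//.
  have := sqnorm_parallelogram_le (y - x0) (x0 - y0).
  rewrite addrA subrK; move: yK x0y0; rewrite /K /= !expr_div_n.
  have : 0 < r ^+ 2 by rewrite exprn_gt0.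
  lra.
set s := r `^ (4%:R / 3%:R) in sup_lt ult.
have s0 : 0 < s by rewrite powR_gt0.
(* With this opening the barrier equals [k / 4 * s] on the sphere of radius [r / 2], whence the
   constant [k / 4]; since [s ^+ 3 = r ^+ 4], its infinity Laplacian there is [2 * k ^+ 3], free of
   [r]. *)
pose a := k * s / r ^+ 2.
have a0 : 0 < a by rewrite divr_gt0 ?mulr_gt0// exprn_gt0.
have ar : a * (r / 2) ^+ 2 = k / 4 * s by rewrite /a; field; rewrite gt_eqF.
have a3 : 8 * a ^+ 3 * (r / 2) ^+ 2 = 2 * k ^+ 3.
  rewrite /a !expr_div_n exprMn powR_4_3_expr3//; field.
  by rewrite gt_eqF.
have sq00 : sqnorm (x0 - x0) = 0.
  by rewrite subrr /sqnorm big1// => i _; rewrite mxE expr0n.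
have x0K : K x0 by rewrite /K /= sq00 exprn_ge0// divr_ge0// ltW.
have [z /set_mem zK zmax] : exists2 z, z \in K &
    forall t, t \in K -> u t - a * sqnorm (t - x0) <= u z - a * sqnorm (z - x0).
  apply: EVT_max_rV; [by exists x0|exact: compact_sqnorm_le|].
  apply: within_continuousB.
    apply: continuous_subspaceW uC.
    by apply: subset_trans Ksub _; apply: subset_trans rsub _; exact: subset_closure.
  apply: continuous_subspaceT => y.
  exact: (cvgM (cvg_cst a) (continuous_sqnorm_sub x0 y)).
(* The maximum is at least the value [u x0 > 0] at the centre. This also puts [z] where [u] is
   positive, as the viscosity inequality [uge] requires. *)
have uz : a * sqnorm (z - x0) < u z.
  by have := zmax x0 (mem_set x0K); rewrite sq00 mulr0; lra.
have zB : eball 0 1 z by apply: rsub; exact: Ksub.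
have zpos : positivity_set (eball 0 1) u z.
  by split => //=; apply: le_lt_trans uz; rewrite mulr_ge0 ?sqnorm_ge0// ltW.
(* [a * sqnorm (z - x0) < u z < k / 4 * s], and the last quantity is the value of the barrier on the
   sphere. *)
have zint : sqnorm (z - x0) < (r / 2) ^+ 2.
  by rewrite -(ltr_pM2l a0) ar; exact: lt_trans (ult _ (Ksub _ zK)).
(* The barrier is raised by the maximum value, so that it touches [u] from above at [z]. *)
pose phi t := a * sqnorm (t - x0) + (u z - a * sqnorm (z - x0)).
have : f z <= inf_laplacian phi z.
  apply: uge => //; first exact: C2_on_paraboloid.
  split; first by rewrite /phi; ring.
  have : nbhs z [set y | sqnorm (y - x0) < (r / 2) ^+ 2].
    by apply: open_nbhs_nbhs; split => //; exact: open_sqnorm_lt.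
  apply: filterS => t /ltW tK.
  by have := zmax t (mem_set tK); rewrite /phi; lra.
rewrite inf_laplacian_paraboloid => fz.
have /andP[nuf _] := fnu z zB.
suff : 8 * a ^+ 3 * sqnorm (z - x0) <= 2 * k ^+ 3 by lra.
by rewrite -a3 ler_wpM2l// mulr_ge0// exprn_ge0// ltW.
Qed.
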